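(* Let $(Z_i)_{i\in\mathbb N}$ be independent with $Z_i\sim N(\mu r_i,1)$, where $\mu>0$ and $r_i\in\{0,1\}$ are fixed, and let $p_i=1-\Phi(Z_i)$. Let $\alpha,\beta\in(0,1)$ and a threshold $c$ be fixed. Consider the online adaptively ordered martingale test with threshold $c$: hypothesis $t$ is included in the set $M$ iff $|Z_t|>c$ (equivalently $\Phi^{-1}(1-g(p_t))>c$), and the test rejects iff at some time the current set $M$ with $K=|M|\ge1$ satisfies $\sum_{i\in M}h(p_i)>C_K^\alpha K^{1/2}$. This test has power at least $1-\beta$ if there exists $k\in\mathbb N$ such that $$(2S(\mu;c)-1)\left(N_1(k)-\frac{C_k^{\beta/3}\sqrt{N_1(k)}}{2\mathbb P(|Z(\mu)|>c)}\right)\ \ge\ \frac{C_k^\alpha+C_k^{\beta/3}}{\mathbb P^{1/2}(|Z(\mu)|>c)}\left[N_1(k)+D^{-1}(c)N_0(k)+\frac{C_k^{\beta/3}k^{1/2}}{2\mathbb P(|Z(\mu)|>c)}\right]^{1/2}.$$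
   Context: $\Phi$ is the standard Gaussian CDF; $h(p)=2\cdot\mathbf 1\{p<0.5\}-1$, $g(p)=\min\{p,1-p\}$. $Z(\nu)$ denotes a $N(\nu,1)$ random variable. For $\gamma\in(0,1)$, $k\ge1$: $C_k^\gamma=1.7\sqrt{\log\log(2k)+0.72\log\frac{5.2}{\gamma}}$. $D(c)=\frac{\mathbb P(|Z(\mu)|>c)}{\mathbb P(|Z(0)|>c)}$, $S(\mu;c)=\mathbb P(Z(\mu)>0\mid |Z(\mu)|>c)$, $N_1(k)=\sum_{i=1}^kr_i$, $N_0(k)=\sum_{i=1}^k(1-r_i)$. Power is the probability of rejection. *)

(* Defs.v *)
From HB Require Import structures.
From mathcomp Require Import all_boot all_order all_algebra.
From mathcomp Require Import all_classical all_reals all_analysis.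
Set Implicit Arguments. Unset Strict Implicit. Unset Printing Implicit Defensive.
Import Order.TTheory GRing.Theory Num.Theory.
Local Open Scope classical_set_scope.
Local Open Scope ring_scope.

Section defs.
Context {R : realType}.

Definition Phi (x : R) : R := fine (normal_prob 0 1 `]-oo, x]).

Definition hfun (p : R) : R := 2 * (if p < 2^-1 then 1 else 0) - 1.

Definition gfun (p : R) : R := Num.min p (1 - p).

Definition Ck (k : nat) (gamma : R) : R :=
  (17%:R / 10%:R) * Num.sqrt (ln (ln (2 * k%:R)) + (72%:R / 100%:R) * ln ((52%:R / 10%:R) / gamma)).

Definition Pincl (nu c : R) : R := fine (normal_prob nu 1 [set x : R | c < `|x|]).

Definition Dfun (mu c : R) : R := Pincl mu c / Pincl 0 c.

Definition Sfun (mu c : R) : R :=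
  fine (normal_prob mu 1 [set x : R | 0 < x /\ c < `|x|]) / Pincl mu c.

(* N_1(k) = sum_{i=1}^k r_i, N_0(k) = sum_{i=1}^k (1 - r_i);
   hypotheses are indexed 0,1,2,... so the first k are i < k. *)
Definition N1 (r : nat -> bool) (k : nat) : R := \sum_(i < k) (r i)%:R.
Definition N0 (r : nat -> bool) (k : nat) : R := \sum_(i < k) (~~ r i)%:R.

End defs.

Section prob.
Context {R : realType} {d : measure_display} {T : measurableType d}.

Definition mutually_independent (P : probability T R) (Z : nat -> T -> R) : Prop :=
  forall (s : seq nat) (B : nat -> set R), uniq s ->
    (forall i, i \in s -> measurable (B i)) ->
    P (\bigcap_(i in [set j | j \in s]) (Z i @^-1` B i)) =
    (\big[*%E/1%E]_(i <- s) P (Z i @^-1` B i))%E.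

Definition pval (Z : nat -> T -> R) (i : nat) (w : T) : R := 1 - Phi (Z i w).

Definition Mset (Z : nat -> T -> R) (c : R) (n : nat) (w : T) : seq nat :=
  [seq i <- iota 0 n | c < `|Z i w|].

Definition reject_event (Z : nat -> T -> R) (c alpha : R) : set T :=
  [set w | exists n : nat,
     let M := Mset Z c n w in
     let K := size M in
     (1 <= K)%N /\
     Ck K alpha * Num.sqrt (K%:R) < \sum_(i <- M) hfun (pval Z i w)].

End prob.

(* Main.v *)
Require Import Defs.
From HB Require Import structures.
From mathcomp Require Import all_boot all_order all_algebra.
From mathcomp Require Import all_classical all_reals all_analysis.
From mathcomp Require Import measurable_realfun ring lra.
Set Implicit Arguments. Unset Strict Implicit. Unset Printing Implicit Defensive.
Import Order.TTheory GRing.Theory Num.Theory.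
Import numFieldNormedType.Exports.
Local Open Scope classical_set_scope.
Local Open Scope ring_scope.

(* It suffices that the test rejects at the time k of the hypothesis. Write
   C = C_k^{beta/3}, p1 = P(|Z(mu)| > c), p0 = P(|Z(0)| > c), and S for
   S(mu; c). Only the first k signals (not selected, selected with positive
   sign, selected with nonpositive sign) matter; they are independent, so the
   problem lives on a finite product. By Hoeffding's inequality each of
     |M| >= b := p1 N1 + p0 N0 + C sqrt(k) / 2,
     #(nonnulls in M) <= a := p1 N1 - C sqrt(N1) / 2,
     sum of the signs on M <= its conditional mean given M - C sqrt |M|
   has probability at most exp(- C^2 / 2) <= beta / 3, the last one after
   conditioning on M: given M the signs are independent, with mean 2 S - 1 for
   a nonnull and 0, by symmetry, for a null. Outside these events the sum of
   the signs exceeds (2 S - 1) a - C sqrt |M|, and the assumption multiplied by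
   p1 reads (2 S - 1) a >= (C_k^alpha + C) sqrt b. *)

(** * Hoeffding's inequalities on a finite product *)

Lemma is_derive_ge0_le {R : realType} (f df : R -> R) (x : R) :
  (forall y : R, is_derive y 1 f (df y)) ->
  (forall y, 0 < y -> 0 <= df y) -> 0 <= x -> f 0 <= f x.
Proof.
move=> fE df0; rewrite le_eqVlt => /predU1P[<-//|x0].
have [|z zx /eqP] := MVT x0 (fun z _ => fE z).
  by apply: derivable_within_continuous => y _; case: (fE y).
rewrite subr_eq => /eqP ->.
by rewrite lerDr mulr_ge0 ?subr_ge0 ?(ltW x0)// df0// (itvP zx).
Qed.

(* The tilted mean [p * expR x / g x] has derivative at most 1/4 by AM-GM, hence
   it is at most [p + x / 4] (this is [qle]); that makes the centred moment
   generating function divided by [expR (x ^+ 2 / 8)] nonincreasing. *)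
Lemma mgf_bernoulli_pos {R : realType} (p l : R) : 0 <= p <= 1 -> 0 <= l ->
  p * expR (l * (1 - p)) + (1 - p) * expR (- (l * p)) <= expR (l ^+ 2 / 8).
Proof.
move=> /andP[p0 p1] l0.
pose g (x : R) : R := 1 - p + p * expR x.
have g0 x : 0 < g x.
  have := expR_gt0 x; rewrite /g => e0.
  have : 0 <= p * expR x by rewrite mulr_ge0// ltW.
  have [->|] := eqVneq p 1; first by rewrite mul1r; lra.
  move=> pn1; have : p < 1 by rewrite lt_neqAle pn1.
  by lra.
have dg (x : R) : is_derive x 1 g (p * expR x).
  by apply: is_derive_eq; rewrite /GRing.scale/=; ring.
have qle x : 0 <= x -> p * expR x <= (p + x / 4) * g x.
  (* Since [g x - p * expR x = 1 - p], [v x] is [p + x / 4] minus the tilted mean. *)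
  move=> x0; pose v (x : R) : R := p + x / 4 + (1 - p) * (g x)^-1 - 1.
  have dv (y : R) : is_derive y 1 v (1 / 4 - (1 - p) * p * expR y / g y ^+ 2).
    have gy : g y != 0 by rewrite gt_eqF.
    have dV := is_deriveV gy (dg y).
    apply: is_derive_eq; rewrite /GRing.scale/=; field.
    by rewrite gy.
  have v0 : v 0 = 0 by rewrite /v /g expR0 mulr1 subrK invr1; ring.
  have : 0 <= v x.
    rewrite -v0; apply: (is_derive_ge0_le dv) => // y y0.
    rewrite subr_ge0 ler_pdivrMr ?exprn_gt0// /g.
    rewrite -subr_ge0.
    have -> : 1 / 4 * (1 - p + p * expR y) ^+ 2 - (1 - p) * p * expR y =
              (1 - p - p * expR y) ^+ 2 / 4 by field.
    by rewrite divr_ge0// sqr_ge0.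
  move=> /mulr_ge0 /(_ (ltW (g0 x))); rewrite /v.
  rewrite mulrBl mulrDl mulfVK ?gt_eqF// => H.
  by rewrite -subr_ge0; apply: le_trans H _; rewrite /g; lra.
pose h (x : R) : R := - (g x * expR (- (x * p) - x ^+ 2 / 8)).
have dh (x : R) : is_derive x 1 h
    (expR (- (x * p) - x ^+ 2 / 8) * ((p + x / 4) * g x - p * expR x)).
  by apply: is_derive_eq; rewrite /GRing.scale/=; field.
have h0 : h 0 = - 1.
  by rewrite /h /g mul0r expr0n/= mul0r subr0 oppr0 expR0 !mulr1 subrK.
have : h 0 <= h l.
  apply: (is_derive_ge0_le dh) => // y y0.
  by rewrite mulr_ge0 ?expR_ge0// subr_ge0 qle// ltW.
rewrite h0 lerN2.
rewrite expRB mulrA ler_pdivrMr ?expR_gt0// mul1r; apply: le_trans.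
rewrite /g [leRHS]mulrDl -mulrA -expRD addrC.
by have -> : l * (1 - p) = l + - (l * p) by ring.
Qed.

(** For negative [l], exchange success and failure: [p] becomes [1 - p] and [l] becomes [- l]. *)
Lemma mgf_bernoulli {R : realType} (p l : R) : 0 <= p <= 1 ->
  p * expR (l * (1 - p)) + (1 - p) * expR (- (l * p)) <= expR (l ^+ 2 / 8).
Proof.
move=> p01; have [l0|l0] := leP 0 l; first exact: mgf_bernoulli_pos.
have q01 : 0 <= 1 - p <= 1 by lra.
have Nl0 : 0 <= - l by lra.
have := mgf_bernoulli_pos q01 Nl0; rewrite sqrrN.
have -> : - l * (1 - (1 - p)) = - (l * p) by ring.
have -> : - (- l * (1 - p)) = l * (1 - p) by ring.
by rewrite subKr addrC.
Qed.

(** Markov's inequality for the exponential; the sum over [f] of products over [i] then factors into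
    a product of sums. The weights may be sub-probabilities, which allows restriction to a given
    selected set. *)
Lemma chernoff_prod {R : realType} (I O : finType) (q G : I -> O -> R)
    (w : I -> R) (t : R) :
  (forall i o, 0 <= q i o) ->
  (forall i, \sum_o q i o * expR (G i o) <= w i) ->
  \sum_(f : {ffun I -> O} | t <= \sum_i G i (f i)) \prod_i q i (f i)
    <= expR (- t) * \prod_i w i.
Proof.
move=> q0 qw; apply: (@le_trans _ _ (expR (- t) *
    \sum_(f : {ffun I -> O}) \prod_i (q i (f i) * expR (G i (f i))))).
  rewrite mulr_sumr big_mkcond/=; apply: ler_sum => f _.
  rewrite big_split/= -expR_sum mulrCA -expRD.
  have q'0 : 0 <= \prod_i q i (f i) by rewrite prodr_ge0.
  case: ifPn => [tG|_]; last by rewrite mulr_ge0// expR_ge0.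
  by rewrite ler_peMr// -[leLHS]expR0 ler_expR; lra.
rewrite ler_wpM2l ?expR_ge0//.
rewrite -(bigA_distr_bigA (fun i o => q i o * expR (G i o))).
apply: ler_prod => i _; rewrite qw andbT.
by apply: sumr_ge0 => o _; rewrite mulr_ge0 ?expR_ge0.
Qed.

Lemma sum_option_bool {R : realType} (F : option bool -> R) :
  \sum_o F o = F None + F (Some true) + F (Some false).
Proof.
rewrite (bigD1 None)//= (bigD1 (Some true))//= (bigD1 (Some false))//=.
by rewrite big1 ?addr0 ?addrA// => -[[]|].
Qed.

(* Law of the signal of one hypothesis: it is selected with probability [p], and
   then its sign is positive with probability [s]. *)
Definition sign_weight {R : realType} (p s : R) (o : option bool) : R :=
  match o with None => 1 - p | Some b => p * (if b then s else 1 - s) end.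

(** The value of [hfun] at a selected hypothesis. The value 0 for [None] lets sums over the selected
    set run over all indices. *)
Definition osign {R : realType} (o : option bool) : R :=
  match o with None => 0 | Some b => if b then 1 else - 1 end.

Section sign_weights.
Context {R : realType} {I : finType} (p s : I -> R).
Hypotheses (p01 : forall i, 0 <= p i <= 1) (s01 : forall i, 0 <= s i <= 1).

Let q i := sign_weight (p i) (s i).

Lemma sign_weight_ge0 i o : 0 <= q i o.
Proof.
have := p01 i; have := s01 i => /andP[s0 s1] /andP[p0 p1].
by case: o => [[]|]; rewrite /q/= ?mulr_ge0// subr_ge0.
Qed.

Lemma sum_sign_weight i : \sum_o q i o = 1.
Proof. by rewrite sum_option_bool /q/=; ring. Qed.

Lemma sum_prod_sign_weight :
  \sum_(f : {ffun I -> option bool}) \prod_i q i (f i) = 1.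
Proof.
rewrite -(bigA_distr_bigA (fun i o => q i o)).
by rewrite big1// => i _; exact: sum_sign_weight.
Qed.

(** The sign [e], 1 or -1, chooses the upper or the lower tail. It serves with [D] the set of all
    hypotheses and with [D] the nonnulls. *)
Lemma count_tail (D : pred I) (e C : R) : e ^+ 2 = 1 -> (0 < #|D|)%N -> 0 <= C ->
  \sum_(f : {ffun I -> option bool} |
        C / 2 * Num.sqrt #|D|%:R <= \sum_(i | D i) e * ((isSome (f i))%:R - p i))
    \prod_i q i (f i) <= expR (- (C ^+ 2 / 2)).
Proof.
move=> e2 D0 C0; pose n : R := Num.sqrt #|D|%:R.
have n0 : 0 < n by rewrite sqrtr_gt0 ltr0n.
have n2 : n ^+ 2 = #|D|%:R by rewrite sqr_sqrtr.
(* This [l] minimizes the exponent [n ^+ 2 * (l ^+ 2 / 8) - l * (C / 2 * n)]; the minimum is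
   [- (C ^+ 2 / 2)]. *)
pose l := 2 * C / n; have l0 : 0 <= l by rewrite divr_ge0 ?mulr_ge0// ltW.
pose G i (o : option bool) : R :=
  if D i then l * (e * ((isSome o)%:R - p i)) else 0.
pose w i : R := if D i then expR (l ^+ 2 / 8) else 1.
have qw i : \sum_o q i o * expR (G i o) <= w i.
  rewrite /G /w; case: ifPn => _; last first.
    by under eq_bigr do rewrite expR0 mulr1; rewrite sum_sign_weight.
  rewrite sum_option_bool /q/=.
  have := mgf_bernoulli (l * e) (p01 i); rewrite exprMn e2 mulr1.
  apply: le_trans; rewrite le_eqVlt; apply/orP; left; apply/eqP.
  have -> : l * (e * (0 - p i)) = - (l * e * p i) by ring.
  have -> : l * (e * (1 - p i)) = l * e * (1 - p i) by ring.
  by ring.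
have := chernoff_prod (C ^+ 2) sign_weight_ge0 qw.
rewrite (_ : \prod_i w i = expR (C ^+ 2 / 2)); last first.
  rewrite /w -big_mkcond/= prodr_const -expRM_natl -n2 /l; congr expR.
  by field; rewrite gt_eqF.
rewrite -expRD (_ : - C ^+ 2 + C ^+ 2 / 2 = - (C ^+ 2 / 2)); last by field.
apply: le_trans; rewrite big_mkcond [leRHS]big_mkcond/=; apply: ler_sum => f _.
have q'0 : 0 <= \prod_i q i (f i).
  by apply: prodr_ge0 => i _; exact: sign_weight_ge0.
case: ifPn => [H|_]; last by case: ifP.
rewrite ifT// /G -big_mkcond/= -mulr_sumr.
have -> : C ^+ 2 = l * (C / 2 * n) by rewrite /l; field; rewrite gt_eqF.
by rewrite ler_wpM2l.
Qed.

(* The exponential tilt [l] depends on the selected set [A], so Chernoff's bound is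
   applied separately on each event [M f = A]; the resulting factors
   [\prod_i (if i \in A then p i else 1 - p i)] are the probabilities of these
   events and sum to 1. *)
Lemma sign_tail (C : R) : 0 <= C ->
  \sum_(f : {ffun I -> option bool} |
     (0 < #|[set i | isSome (f i)]%SET|)%N &&
     (\sum_(i | isSome (f i)) (osign (f i) - (2 * s i - 1))
       <= - (C * Num.sqrt #|[set i | isSome (f i)]%SET|%:R)))
    \prod_i q i (f i) <= expR (- (C ^+ 2 / 2)).
Proof.
move=> C0.
pose M (f : {ffun I -> option bool}) := [set i | isSome (f i)]%SET.
rewrite (partition_big M xpredT)//=.
have prA : \sum_(A : {set I}) \prod_i (if i \in A then p i else 1 - p i) = 1.
  rewrite -bigA_distr big1//= => i _; ring.
rewrite -[leRHS]mulr1 -[X in _ <= _ * X]prA mulr_sumr.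
apply: ler_sum => A _; have [->|[j jA]] := set_0Vmem A.
  rewrite big_pred0; last first.
    move=> f; apply/negP => /andP[/andP[+ _] /eqP Mf].
    by rewrite -[finset _]/(M f) Mf cards0.
  rewrite mulr_ge0 ?expR_ge0//; apply: prodr_ge0 => i _.
  by have := p01 i => /andP[p0 p1]; rewrite inE subr_ge0.
pose n : R := Num.sqrt #|A|%:R.
have n0 : 0 < n by rewrite sqrtr_gt0 ltr0n card_gt0; apply/set0Pn; exists j.
have n2 : n ^+ 2 = #|A|%:R by rewrite sqr_sqrtr.
(* Signs have range 2, so the exponent is [n ^+ 2 * (l ^+ 2 / 2) - l * (C * n)], again with minimum
   [- (C ^+ 2 / 2)]. *)
pose l := C / n; have l0 : 0 <= l by rewrite divr_ge0 ?mulr_ge0// ltW.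
(* [qA] drops the outcomes incompatible with [M f = A]; the mass left at [i] is [p i] or
   [1 - p i]. *)
pose qA i (o : option bool) : R := if isSome o == (i \in A) then q i o else 0.
pose G i (o : option bool) : R :=
  if isSome o then - l * (osign o - (2 * s i - 1)) else 0.
pose w i : R := (if i \in A then expR (l ^+ 2 / 2) else 1) *
  (if i \in A then p i else 1 - p i).
have qA0 i o : 0 <= qA i o by rewrite /qA; case: ifP => _; rewrite ?sign_weight_ge0.
have qw i : \sum_o qA i o * expR (G i o) <= w i.
  rewrite sum_option_bool /qA /G /w /q/=; case: (i \in A) => /=; last first.
    by rewrite expR0 mulr1 mul1r !mul0r !addr0.
  rewrite mul0r add0r.
  have := mgf_bernoulli (- (2 * l)) (s01 i).
  have -> : - (2 * l) * (1 - s i) = - l * (1 - (2 * s i - 1)) by ring.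
  have -> : - (- (2 * l) * s i) = - l * (- 1 - (2 * s i - 1)) by ring.
  have -> : (- (2 * l)) ^+ 2 / 8 = l ^+ 2 / 2 by field.
  have /andP[p0 _] := p01 i => /(ler_wpM2l p0).
  by rewrite mulrDr !mulrA [_ * p i]mulrC.
have := chernoff_prod (C ^+ 2) qA0 qw.
rewrite big_split/= -big_mkcond/= prodr_const -expRM_natl -n2.
rewrite (mulrA (expR (- C ^+ 2))) -expRD.
have -> : - C ^+ 2 + n ^+ 2 * (l ^+ 2 / 2) = - (C ^+ 2 / 2).
  by rewrite /l; field; rewrite gt_eqF.
apply: le_trans; rewrite big_mkcond [leRHS]big_mkcond/=; apply: ler_sum => f _.
have qA'0 : 0 <= \prod_i qA i (f i) by apply: prodr_ge0.
case: ifPn => [/andP[/andP[_ H] /eqP MfA]|_]; last by case: ifP.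
have fA i : isSome (f i) = (i \in A) by rewrite -MfA inE.
rewrite ifT; last first.
  rewrite /G -big_mkcond/= -mulr_sumr mulNr -mulrN.
  have -> : C ^+ 2 = l * (C * n) by rewrite /l; field; rewrite gt_eqF.
  by rewrite ler_wpM2l// lerNr /n -MfA.
by apply: ler_prod => i _; rewrite sign_weight_ge0/= /qA fA eqxx.
Qed.

End sign_weights.

(** * The boundary C_k *)

Section boundary.
Context {R : realType}.
Implicit Types (k : nat) (g : R).

Lemma ln2_ge_half : 1 / 2 <= ln 2 :> R.
Proof.
rewrite -ler_expR lnK ?posrE// -lef_pV2 ?posrE ?expR_gt0// -expRN.
by have := expR_ge1Dx (- (1 / 2) : R); lra.
Qed.

(** [ln (2 * k) >= ln 2 >= 1 / 2]. *)
Lemma lnln_ge k : (1 <= k)%N -> - ln 2 <= ln (ln (2 * k%:R)) :> R.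
Proof.
move=> k1; have k1' : 1 <= k%:R :> R by rewrite ler1n.
have ln2 := ln2_ge_half.
have ln2k : ln 2 <= ln (2 * k%:R) :> R by rewrite ler_ln ?posrE; lra.
by rewrite -lnV ?posrE// ler_ln ?posrE; lra.
Qed.

Lemma ln_52_ge : 2 * ln 2 <= ln (52 / 10) :> R.
Proof.
by rewrite mulr_natl -lnXn// ler_ln ?posrE ?exprn_gt0//; lra.
Qed.

Let Ck_arg k g : R :=
  ln (ln (2 * k%:R)) + (72%:R / 100%:R) * ln ((52%:R / 10%:R) / g).

(** [Num.sqrt] is 0 at negative arguments, so squaring [Ck k g] requires this. The term [- ln 2] is
    outweighed by [0.72 * ln 5.2 >= 1.44 * ln 2]. *)
Lemma Ck_arg_gt0 k g : (1 <= k)%N -> 0 < g < 1 -> 0 < Ck_arg k g.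
Proof.
move=> /lnln_ge + /andP[g0 g1]; have := ln_52_ge; have := ln2_ge_half.
rewrite /Ck_arg [ln (_ / g)]ln_div ?posrE//; have : ln g < 0 by rewrite ln_lt0// g0.
by lra.
Qed.

Lemma Ck_ge0 k g : 0 <= Ck k g.
Proof. by rewrite mulr_ge0 ?sqrtr_ge0. Qed.

Lemma Ck_gt0 k g : (1 <= k)%N -> 0 < g < 1 -> 0 < Ck k g.
Proof. by move=> k1 g01; rewrite mulr_gt0 ?sqrtr_gt0 ?Ck_arg_gt0//; lra. Qed.

(** The test uses the boundary at the random size [K] of the selected set; this replaces it by the
    one at [k >= K]. *)
Lemma le_Ck j k g : (1 <= j <= k)%N -> Ck j g <= Ck k g.
Proof.
move=> /andP[j1 jk]; have j1' : 1 <= j%:R :> R by rewrite ler1n.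
have jk' : j%:R <= k%:R :> R by rewrite ler_nat.
apply: ler_wpM2l; first by rewrite divr_ge0.
rewrite ler_wsqrtr// lerD2r.
have ln2 := ln2_ge_half.
have ln2j : ln 2 <= ln (2 * j%:R) :> R by rewrite ler_ln ?posrE; lra.
have ln2k : ln (2 * j%:R) <= ln (2 * k%:R) :> R by rewrite ler_ln ?posrE; lra.
by rewrite ler_ln ?posrE; lra.
Qed.

(* The coefficient of [- ln g] in [(Ck k g) ^+ 2 / 2] is
   [1.7 ^+ 2 / 2 * 0.72 = 1.0404], at least 1, and [1.7 ^+ 2 / 2 = 1.445 <= 2]
   lets [ln 5.2 >= 2 * ln 2] absorb [ln (ln (2 * k)) >= - ln 2]. *)
Lemma expR_Ck_le k g : (1 <= k)%N -> 0 < g < 1 ->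
  expR (- ((Ck k g) ^+ 2 / 2)) <= g.
Proof.
move=> k1 g01; have A0 := Ck_arg_gt0 k1 g01; have [g0 g1] := andP g01.
rewrite exprMn sqr_sqrtr ?(ltW A0)// -[leRHS]lnK ?posrE// ler_expR.
have := lnln_ge k1; have := ln_52_ge; have := ln2_ge_half.
rewrite [ln (_ / g)]ln_div ?posrE//; have : ln g < 0 by rewrite ln_lt0// g0.
by lra.
Qed.

End boundary.

(** * Power on the finite product *)

Definition signs_reject {R : realType} (alpha : R) n (f : {ffun 'I_n -> option bool}) :=
  let K := #|[set i | isSome (f i)]%SET| in
  (0 < K)%N && (Ck K alpha * Num.sqrt K%:R < \sum_i osign (f i)).

Section finite_power.
Context {R : realType} (k : nat) (r : nat -> bool) (p1 p0 s1 alpha beta : R).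
Hypotheses (k_gt0 : (1 <= k)%N) (p1_gt0 : 0 < p1) (p1_le1 : p1 <= 1).
Hypotheses (p0_01 : 0 <= p0 <= 1) (s1_half : 1 / 2 <= s1 <= 1).
Hypothesis beta01 : 0 < beta < 1.

Let Ca := Ck k alpha.
Let C := Ck k (beta / 3).
Let n1 : R := N1 r k.
Let n0 : R := N0 r k.

Hypothesis cond :
  (2 * s1 - 1) * (n1 - C * Num.sqrt n1 / (2 * p1)) >=
  (Ca + C) / Num.sqrt p1 *
    Num.sqrt (n1 + (p1 / p0)^-1 * n0 + C * Num.sqrt k%:R / (2 * p1)).

Let a := p1 * n1 - C / 2 * Num.sqrt n1.
Let b := p1 * n1 + p0 * n0 + C / 2 * Num.sqrt k%:R.

Let p (i : 'I_k) := if r i then p1 else p0.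
Let s (i : 'I_k) := if r i then s1 else 1 / 2.

Let beta3 : 0 < beta / 3 < 1. Proof. by move: beta01 => /andP[? ?]; lra. Qed.

Let C_gt0 : 0 < C. Proof. exact: Ck_gt0. Qed.

Let n1E : n1 = #|[pred i : 'I_k | r i]|%:R.
Proof.
rewrite /n1 /N1 -natr_sum -sum1_card [in RHS]big_mkcond/=.
by congr (_%:R); apply: eq_bigr => i _; rewrite inE; case: (r i).
Qed.

Let n1_ge0 : 0 <= n1. Proof. by rewrite n1E. Qed.
Let n0_ge0 : 0 <= n0. Proof. by rewrite /n0 /N0 sumr_ge0. Qed.

Let b_gt0 : 0 < b.
Proof.
have /andP[p00 _] := p0_01.
rewrite /b ltr_wpDl ?addr_ge0 ?mulr_ge0 ?(ltW p1_gt0)//.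
by rewrite mulr_gt0 ?divr_gt0// sqrtr_gt0 ltr0n.
Qed.

(** After multiplication by [p1], one factor [Num.sqrt p1] cancels the denominator and the other
    enters the root, where [p1] times the bracket is [b]. *)
Let cond_scaled : (Ca + C) * Num.sqrt b <= (2 * s1 - 1) * a.
Proof.
have sp0 : 0 < Num.sqrt p1 by rewrite sqrtr_gt0.
have sp2 : Num.sqrt p1 ^+ 2 = p1 by rewrite sqr_sqrtr// ltW.
have -> : b = p1 * (n1 + (p1 / p0)^-1 * n0 + C * Num.sqrt k%:R / (2 * p1)).
  by rewrite invf_div /b; field; rewrite gt_eqF.
rewrite sqrtrM ?(ltW p1_gt0)//.
have := ler_wpM2r (ltW p1_gt0) cond.
set X := Num.sqrt (_ + _ + _); rewrite -{2}sp2.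
have -> : (Ca + C) / Num.sqrt p1 * X * Num.sqrt p1 ^+ 2
  = (Ca + C) * (Num.sqrt p1 * X) by field; rewrite gt_eqF.
by congr (_ <= _); rewrite /a; field; rewrite gt_eqF.
Qed.

(** The left side of [cond_scaled] is positive and [2 * s1 - 1 >= 0]. It follows that nonnulls exist
    and, outside the bad events, that the selected set is nonempty. *)
Let a_gt0 : 0 < a.
Proof.
have C1 : 0 < Ca + C by rewrite ltr_wpDl// Ck_ge0.
have sb : 0 < Num.sqrt b by rewrite sqrtr_gt0.
have := lt_le_trans (mulr_gt0 C1 sb) cond_scaled.
move/andP: s1_half => [s1h _].
by apply: contraTT; rewrite -!leNgt => a0; rewrite mulr_ge0_le0//; lra.
Qed.

Let n1_gt0 : 0 < n1.
Proof.
rewrite lt_neqAle n1_ge0 andbT; apply/eqP => n10.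
by have := a_gt0; rewrite /a -n10 sqrtr0 !mulr0 subr0 ltxx.
Qed.

(** Pointwise form of the union bound: an outcome without rejection lies in one of the three bad
    events. *)
Let tails (f : {ffun 'I_k -> option bool}) : [|| signs_reject alpha f,
  C / 2 * Num.sqrt #|'I_k|%:R <= \sum_(i < k | xpredT i) 1 * ((isSome (f i))%:R - p i),
  C / 2 * Num.sqrt #|[pred i : 'I_k | r i]|%:R <=
     \sum_(i < k | r i) (- 1) * ((isSome (f i))%:R - p i) |
  (0 < #|[set i | isSome (f i)]%SET|)%N &&
     (\sum_(i | isSome (f i)) (osign (f i) - (2 * s i - 1))
       <= - (C * Num.sqrt #|[set i | isSome (f i)]%SET|%:R))].
Proof.
apply/negPn/negP; rewrite !negb_or -!ltNge => /and4P[/negP rej].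
set K := #|[set _ | _]%SET|; rewrite card_ord -n1E => up low dev.
rewrite -mulr_sumr sumrB mul1r in up; rewrite -mulr_sumr sumrB in low.
pose m : R := \sum_(i < k | r i) (isSome (f i))%:R.
have KE : K%:R = \sum_(i < k) (isSome (f i))%:R :> R.
  rewrite -natr_sum /K -sum1_card [in LHS]big_mkcond/=; congr (_%:R).
  by apply: eq_bigr => i _; rewrite inE; case: (f i).
have sump1 : \sum_(i < k | r i) p i = p1 * n1.
  rewrite (eq_bigr (fun=> p1)); last by move=> i; rewrite /p => ->.
  by rewrite sumr_const n1E mulr_natr.
have sump : \sum_(i < k) p i = p1 * n1 + p0 * n0.
  rewrite (bigID (fun i : 'I_k => r i))/= sump1; congr (_ + _).
  rewrite (eq_bigr (fun=> p0)); last by move=> i; rewrite /p => /negbTE ->.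
  by rewrite /n0 /N0 mulr_sumr big_mkcond; apply: eq_bigr => i _; case: ifP;
    rewrite ?mulr1 ?mulr0.
have Kb : K%:R < b by move: up; rewrite KE sump /b; lra.
have ma : a < m by move: low; rewrite sump1 /a -/m; lra.
have mK : m <= K%:R.
  by rewrite KE [leRHS](bigID (fun i : 'I_k => r i))/= lerDl sumr_ge0.
have K0 : (0 < K)%N by rewrite -(ltr0n R); have := a_gt0; lra.
have Kk : (K <= k)%N by rewrite -[leqRHS](card_ord k) max_card.
apply: rej; rewrite /signs_reject -/K K0/=.
move: dev; rewrite K0/= -ltNge sumrB.
have -> : \sum_(i | isSome (f i)) osign (f i) = \sum_i osign (f i) :> R.
  by rewrite big_mkcond; apply: eq_bigr => i _; case: (f i).
(* A null has [s i = 1 / 2], hence mean sign 0; only the [m] selected nonnulls contribute. *)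
have -> : \sum_(i | isSome (f i)) (2 * s i - 1) = (2 * s1 - 1) * m.
  rewrite /m mulr_sumr big_mkcond [RHS]big_mkcond/=; apply: eq_bigr => i _.
  rewrite /s; case: (f i) => [x|]/=; case: (r i) => //=.
  - by rewrite mulr1.
  - by field.
  - by rewrite mulr0.
move=> dev.
have s2 : 0 <= 2 * s1 - 1 by move/andP: s1_half; lra.
have := ler_wpM2l s2 (ltW ma).
have sKb : Num.sqrt K%:R <= Num.sqrt b by rewrite ler_wsqrtr// ltW.
have := ler_wpM2l (addr_ge0 (Ck_ge0 k alpha) (Ck_ge0 k (beta / 3))) sKb.
have CK : Ck K alpha <= Ca by rewrite le_Ck// K0.
have := ler_wpM2r (sqrtr_ge0 K%:R) CK.
have := cond_scaled.
(* The sum of signs exceeds [(2 * s1 - 1) * a - C * Num.sqrt K], which is at least [(Ca + C) *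
   Num.sqrt b - C * Num.sqrt K >= Ca * Num.sqrt K]. *)
rewrite -/C -/Ca !mulrDl; move: dev; lra.
Qed.

Lemma finite_power : 1 - beta <=
  \sum_(f : {ffun 'I_k -> option bool} | signs_reject alpha f)
    \prod_i sign_weight (p i) (s i) (f i).
Proof.
have p01 i : 0 <= p i <= 1 by rewrite /p; case: ifP => // _; rewrite p1_le1 ltW.
have s01 i : 0 <= s i <= 1.
  by rewrite /s; case: ifP => _; move/andP: s1_half; lra.
have C0 := ltW C_gt0.
have e1 : (1 : R) ^+ 2 = 1 by rewrite expr1n.
have e2 : (- 1 : R) ^+ 2 = 1 by rewrite sqrrN expr1n.
have D1 : (0 < #|'I_k|)%N by rewrite card_ord.
have D2 : (0 < #|[pred i : 'I_k | r i]|)%N.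
  by rewrite -(ltr0n R) -n1E.
have Cbeta : expR (- (C ^+ 2 / 2)) <= beta / 3 by rewrite expR_Ck_le.
have up := le_trans (count_tail p01 s01 e1 D1 C0) Cbeta.
have low := le_trans (count_tail p01 s01 e2 D2 C0) Cbeta.
have dev := le_trans (sign_tail p01 s01 C0) Cbeta.
rewrite lerBlDr (_ : beta = beta / 3 + beta / 3 + beta / 3); last by field.
apply: le_trans (lerD (lexx _) (lerD (lerD up low) dev)).
(* Writing 1 as the total mass reduces the union bound to a comparison for each [f]. *)
rewrite -[leLHS](sum_prod_sign_weight p s).
rewrite [X in _ <= X + _]big_mkcond [X in _ <= _ + (X + _ + _)]big_mkcond/=.
rewrite [X in _ <= _ + (_ + X + _)]big_mkcond [X in _ <= _ + (_ + X)]big_mkcond/=.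
rewrite -!big_split/=; apply: ler_sum => f _.
have q0 : 0 <= \prod_i sign_weight (p i) (s i) (f i).
  by apply: prodr_ge0 => i _; exact: sign_weight_ge0.
by case/or4P: (tails f) => ->; repeat case: ifP => ?; lra.
Qed.

End finite_power.

(** * Gaussian symmetry *)

Section gaussian.
Context {R : realType}.
Implicit Types (m c x : R) (A : set R).

Lemma normal_pdf_gt0 m s x : s != 0 -> 0 < normal_pdf m s x.
Proof. by move=> s0; rewrite normal_pdfE// mulr_gt0 ?normal_peak_gt0 ?expR_gt0. Qed.

Lemma normal_pdfN m s x : s != 0 -> normal_pdf m s (- x) = normal_pdf (- m) s x.
Proof.
move=> s0; rewrite !normal_pdfE// /normal_fun opprK.
by rewrite -opprD sqrrN.
Qed.

Lemma normal_probN m s A : s != 0 -> measurable A ->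
  normal_prob m s (-%R @^-1` A) = normal_prob (- m) s A.
Proof.
move=> s0 mA; rewrite /normal_prob.
transitivity (\int[pushforward lebesgue_measure
    (-%R : R -> measurableTypeR R)]_(x in A) (normal_pdf (- m) s x)%:E)%E; last first.
  by apply: eq_measure_integral => //= B mB _; exact: lebesgue_measureN.
rewrite ge0_integral_pushforward//.
- by apply: eq_integral => x _ /=; rewrite -normal_pdfN// opprK.
- by apply/measurable_EFinP/measurable_funTS; exact: measurable_normal_pdf.
- by move=> x _; rewrite lee_fin normal_pdf_ge0.
Qed.

(** If the integral of the density over [A] vanished, the positive density would be 0 almost
    everywhere on [A]. *)
Lemma normal_prob_gt0 m s A : s != 0 -> measurable A ->
  (0 < lebesgue_measure A)%E -> (0 < normal_prob m s A)%E.
Proof.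
move=> s0 mA A0; rewrite lt0e measure_ge0 andbT; apply/eqP => pA0.
have mf : measurable_fun A (fun x => (normal_pdf m s x)%:E).
  by apply/measurable_EFinP/measurable_funTS; exact: measurable_normal_pdf.
have : (\int[lebesgue_measure]_(x in A) `|(normal_pdf m s x)%:E| = 0)%E.
  rewrite -[RHS]pA0; apply: eq_integral => x _.
  by rewrite gee0_abs// lee_fin normal_pdf_ge0.
move=> /(ae_eq_integral_abs lebesgue_measure mA mf) [N [mN N0 AN]].
have : (lebesgue_measure A <= lebesgue_measure N)%E.
  apply: le_measure; rewrite ?inE// => x Ax; apply: AN => /= /(_ Ax)/eqP.
  by rewrite eqe gt_eqF// normal_pdf_gt0.
by rewrite N0 leNgt A0.
Qed.

Lemma normal_prob_setU1 m s A x : measurable A ->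
  normal_prob m s (A `|` [set x]) = normal_prob m s A.
Proof.
move=> mA; apply: measureU0 => //.
have /null_content_dominatesP := @normal_prob_dominates R m s; apply => //.
exact: lebesgue_measure_set1.
Qed.

Definition pos_part c : set R := [set x | 0 < x /\ c < `|x|].
(** For [c < 0] the point 0 is selected; it is placed here because [hfun] is -1 at the p-value
    1/2. *)
Definition neg_part c : set R := [set x | x <= 0 /\ c < `|x|].

Lemma measurable_norm_gt c : measurable [set x : R | c < `|x|].
Proof.
have := @normr_measurable R setT measurableT `]c, +oo[%classic (measurable_itv _).
rewrite setTI; congr measurable.
by apply/seteqP; split => x /=; rewrite in_itv/= andbT.
Qed.

Lemma measurable_pos_part c : measurable (pos_part c).
Proof.
rewrite (_ : pos_part c = `]0, +oo[ `&` [set x : R | c < `|x|]).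
  by apply: measurableI; [exact: measurable_itv|exact: measurable_norm_gt].
by apply/seteqP; split => x /=; rewrite in_itv/= andbT.
Qed.

Lemma measurable_neg_part c : measurable (neg_part c).
Proof.
rewrite (_ : neg_part c = `]-oo, 0] `&` [set x : R | c < `|x|]).
  by apply: measurableI; [exact: measurable_itv|exact: measurable_norm_gt].
by apply/seteqP; split => x /=; rewrite in_itv/=.
Qed.

(** Reflection maps [neg_part c] to a set that differs from [pos_part c] at most by the null set
    [[set 0]]. *)
Lemma normal_prob_neg_part m s c : s != 0 ->
  normal_prob m s (neg_part c) = normal_prob (- m) s (pos_part c).
Proof.
move=> s0; pose A : set R := [set x | 0 <= x /\ c < `|x|].
have mA : measurable A.
  rewrite (_ : A = `[0, +oo[ `&` [set x : R | c < `|x|]).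
    by apply: measurableI; [exact: measurable_itv|exact: measurable_norm_gt].
  by apply/seteqP; split => x /=; rewrite in_itv/= andbT.
have -> : neg_part c = -%R @^-1` A.
  by apply/seteqP; split => x /=; rewrite /A /neg_part/= oppr_ge0 normrN.
rewrite normal_probN// -(normal_prob_setU1 _ _ 0 mA).
rewrite -(normal_prob_setU1 _ _ 0 (measurable_pos_part c)).
congr (normal_prob _ _ _); apply/seteqP; split => x /= [[x0 xc]|->]; try by right.
  by move: x0; rewrite le_eqVlt => /predU1P[<-|x0]; [right|left].
by left; split => //; exact: ltW.
Qed.

(** A positive [x] is at least as close to [m] as to [- m], so the densities compare pointwise. *)
Lemma le_normal_prob_pos_part m c : 0 <= m ->
  (normal_prob (- m) 1 (pos_part c) <= normal_prob m 1 (pos_part c))%E.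
Proof.
move=> m0; apply: ge0_le_integral => //=.
- exact: measurable_pos_part.
- by move=> x _; rewrite lee_fin normal_pdf_ge0.
- by apply/measurable_EFinP/measurable_funTS; exact: measurable_normal_pdf.
- by apply/measurable_EFinP/measurable_funTS; exact: measurable_normal_pdf.
move=> x [x0 _]; rewrite lee_fin !normal_pdfE ?oner_neq0//.
rewrite ler_wpM2l ?normal_peak_ge0// ler_expR expr1n !mulNr lerN2.
rewrite ler_wpM2r// -subr_ge0.
have -> : (x - - m) ^+ 2 - (x - m) ^+ 2 = 4 * (m * x) by ring.
by rewrite !mulr_ge0// ltW.
Qed.

Let g m A : R := fine (normal_prob m 1 A).

Let gE m A : measurable A -> (g m A)%:E = normal_prob m 1 A.
Proof. by move=> mA; rewrite /g fineK// fin_num_measure. Qed.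

Let g_ge0 m A : 0 <= g m A.
Proof. exact/fine_ge0/measure_ge0. Qed.

Let g_neg0 c : g 0 (neg_part c) = g 0 (pos_part c).
Proof. by rewrite /g normal_prob_neg_part ?oner_neq0// oppr0. Qed.

Let g_neg_le m c : 0 <= m -> g m (neg_part c) <= g m (pos_part c).
Proof.
move=> m0; rewrite -lee_fin !gE; [|exact: measurable_pos_part
  |exact: measurable_neg_part].
by rewrite normal_prob_neg_part ?oner_neq0// le_normal_prob_pos_part.
Qed.

Lemma PinclE m c : Pincl m c =
  fine (normal_prob m 1 (pos_part c)) + fine (normal_prob m 1 (neg_part c)).
Proof.
have mp := measurable_pos_part c; have mn := measurable_neg_part c.
apply: EFin_inj; rewrite EFinD !gE//; last exact: measurable_norm_gt.
rewrite -measureU//; last first.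
  by apply/seteqP; split => // x [[x0 _] [/(lt_le_trans x0)]]; rewrite ltxx.
congr (normal_prob _ _ _); apply/seteqP; split => x /=.
  by move=> cx; have [x0|x0] := leP x 0; [right|left].
by case=> -[].
Qed.

Lemma Pincl_gt0 m c : 0 < Pincl m c.
Proof.
rewrite -lte_fin gE; last exact: measurable_norm_gt.
pose J : set R := `]`|c|, `|c| + 1[%classic.
have : (0 < normal_prob m 1 J)%E.
  apply: normal_prob_gt0; [exact: oner_neq0|exact: measurable_itv|].
  rewrite lebesgue_measure_itv/= lte_fin ltrDl ltr01 -EFinD lte_fin.
  by rewrite addrAC subrr add0r.
move=> /lt_le_trans; apply; apply: le_measure.
- by rewrite inE; exact: measurable_itv.
- by rewrite inE; exact: measurable_norm_gt.
move=> x; rewrite /J/= in_itv/= => /andP[cx _].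
by rewrite (le_lt_trans (ler_norm c))// (lt_le_trans cx)// ler_norm.
Qed.

Lemma Pincl_le1 m c : Pincl m c <= 1.
Proof.
rewrite -lee_fin gE; last exact: measurable_norm_gt.
by apply: probability_le1; exact: measurable_norm_gt.
Qed.

Lemma pos_partE m c :
  fine (normal_prob m 1 (pos_part c)) = Pincl m c * Sfun m c.
Proof. by rewrite mulrCA divff ?mulr1// gt_eqF// Pincl_gt0. Qed.

Lemma neg_partE m c :
  fine (normal_prob m 1 (neg_part c)) = Pincl m c * (1 - Sfun m c).
Proof. by rewrite mulrBr mulr1 -pos_partE PinclE addrAC subrr add0r. Qed.

Lemma Sfun0 c : Sfun 0 c = 1 / 2.
Proof.
have := g_neg0 c; rewrite /g pos_partE neg_partE.
by move=> /(mulfI (lt0r_neq0 (Pincl_gt0 0 c))); lra.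
Qed.

Lemma Sfun_ge_half m c : 0 <= m -> 1 / 2 <= Sfun m c <= 1.
Proof.
move=> /(g_neg_le c); rewrite /g pos_partE neg_partE ler_pM2l ?Pincl_gt0//.
have := g_ge0 m (neg_part c); rewrite /g neg_partE pmulr_rge0 ?Pincl_gt0//.
by lra.
Qed.

Lemma Phi0 : Phi 0 = 1 / 2 :> R.
Proof.
(* At threshold -1 the condition on the absolute value is vacuous, so [Sfun0] yields the mass of the
   half-line. *)
have -> : Phi 0 = g 0 (neg_part (-1)).
  rewrite /Phi /g; congr (fine (normal_prob _ _ _)); apply/seteqP.
  split => x /=; rewrite in_itv/=; last by case.
  by move=> x0; split => //; rewrite (lt_le_trans _ (normr_ge0 x)).
rewrite /g neg_partE Sfun0 (_ : Pincl 0 (-1) = 1); first by lra.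
rewrite /Pincl (_ : mkset _ = setT) ?probability_setT//.
by apply/seteqP; split => // x _ /=; rewrite (lt_le_trans _ (normr_ge0 x)).
Qed.

Lemma Phi_gt_half x : (1 / 2 < Phi x) = (0 < x).
Proof.
rewrite -Phi0; have [x0|x0] := ltP 0 x; last first.
  apply/negbTE; rewrite -leNgt /Phi -lee_fin !gE//.
  apply: le_measure; rewrite ?inE// => y /=; rewrite !in_itv/= => yx.
  exact: le_trans x0.
rewrite /Phi -lte_fin !gE// (_ : `]-oo, x]%classic = `]-oo, 0] `|` `]0, x]).
  rewrite measureU//.
    rewrite -[ltLHS]adde0 lteD2lE//.
      rewrite normal_prob_gt0 ?oner_neq0//.
      by rewrite lebesgue_measure_itv/= lte_fin x0 oppr0 adde0 lte_fin.
    by rewrite fin_num_measure.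
  apply/seteqP; split => // y [/=]; rewrite !in_itv/= => y0 /andP[/(le_lt_trans y0)].
  by rewrite ltxx.
apply/seteqP; split => y /=; rewrite !in_itv/=.
  by move=> yx; have [y0|y0] := leP y 0; [left|right; rewrite yx].
by case => [y0|/andP[]//]; rewrite (le_trans y0)// ltW.
Qed.

Lemma hfun_Phi x : hfun (1 - Phi x) = if 0 < x then 1 else -1 :> R.
Proof.
rewrite /hfun (_ : (_ < _) = (1 / 2 < Phi x)); last by apply/idP/idP; lra.
by rewrite Phi_gt_half; case: ifP => _; ring.
Qed.

End gaussian.

(** * From Gaussian variables to the finite product *)

Definition signal {R : realType} (c x : R) : option bool :=
  if c < `|x| then Some (0 < x) else None.

Section signal.
Context {R : realType}.
Implicit Types (m c x : R) (o : option bool).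

Lemma signalTE c : signal c @^-1` [set Some true] = pos_part c.
Proof.
apply/seteqP; rewrite /signal /pos_part; split => x /=.
  by case: ifP => // cx [->].
by case=> x0 ->; rewrite x0.
Qed.

Lemma signalFE c : signal c @^-1` [set Some false] = neg_part c.
Proof.
apply/seteqP; rewrite /signal /neg_part; split => x /=.
  by case: ifP => // cx [] /negbT; rewrite -leNgt.
by case=> x0 ->; rewrite ltNge x0.
Qed.

Lemma signalNE c : signal c @^-1` [set None] = ~` [set x : R | c < `|x|].
Proof.
by apply/seteqP; rewrite /signal; split => x /=; [case: ifP|move=> /negP/negbTE ->].
Qed.

Lemma measurable_signal c o : measurable (signal c @^-1` [set o]).
Proof.
case: o => [[]|]; rewrite ?signalTE ?signalFE ?signalNE.
- exact: measurable_pos_part.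
- exact: measurable_neg_part.
- by apply: measurableC; exact: measurable_norm_gt.
Qed.

Lemma normal_prob_signal m c o :
  normal_prob m 1 (signal c @^-1` [set o]) =
  (sign_weight (Pincl m c) (Sfun m c) o)%:E.
Proof.
have fn A : measurable A -> normal_prob m 1 A \is a fin_num.
  by move=> mA; rewrite fin_num_measure.
case: o => [[]|]/=; rewrite ?signalTE ?signalFE ?signalNE.
- by rewrite -pos_partE fineK// fn//; exact: measurable_pos_part.
- by rewrite -neg_partE fineK// fn//; exact: measurable_neg_part.
rewrite probability_setC; last exact: measurable_norm_gt.
by rewrite EFinB /Pincl fineK// fn//; exact: measurable_norm_gt.
Qed.

End signal.

Section cylinders.
Context {R : realType} {d : measure_display} {T : measurableType d}.
Variables (P : probability T R) (Z : nat -> {RV P >-> R}) (c alpha : R).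

Let cyl n (f : {ffun 'I_n -> option bool}) : set T :=
  [set w | forall i : 'I_n, signal c (Z i w) = f i].

(** This is the form required by [mutually_independent]. The default [None] is never reached, as
    [insub i] succeeds for [i < n]. *)
Lemma cylE n f : @cyl n f = \bigcap_(i in [set j | j \in iota 0 n])
  (Z i @^-1` (signal c @^-1` [set oapp f None (insub i)])).
Proof.
apply/seteqP; split => w.
  move=> wf i /=; rewrite mem_iota/= add0n => ilt.
  by rewrite insubT/= -wf.
move=> wf i; have /= := wf i; rewrite mem_iota/= add0n ltn_ord => /(_ isT).
by rewrite valK.
Qed.

Lemma measurable_cyl n f : measurable (@cyl n f).
Proof.
rewrite cylE; apply: bigcap_measurableType => // i _.
by rewrite -[X in measurable X]setTI; apply: measurable_funP => //;
  exact: measurable_signal.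
Qed.

Lemma prob_cyl n (q : 'I_n -> option bool -> R) f :
  mutually_independent P (fun i => Z i) ->
  (forall (i : 'I_n) o, P (Z i @^-1` (signal c @^-1` [set o])) = (q i o)%:E) ->
  P (@cyl n f) = (\prod_i q i (f i))%:E.
Proof.
move=> indep qE; rewrite cylE indep ?iota_uniq//; last first.
  by move=> i _; exact: measurable_signal.
rewrite -{1}[n]subn0 -/(index_iota 0 n) big_mkord -prodEFin.
by apply: eq_bigr => i _; rewrite valK/= qE.
Qed.

Lemma signs_rejectE n w :
  let M := Mset (fun i => Z i) c n w in
  let K := size M in
  ((1 <= K)%N /\
     Ck K alpha * Num.sqrt (K%:R) < \sum_(i <- M) hfun (pval (fun i => Z i) i w))
  <-> signs_reject alpha [ffun i : 'I_n => signal c (Z i w)].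
Proof.
move=> M K; rewrite /signs_reject.
have KE : #|[set i : 'I_n | isSome ([ffun i : 'I_n => signal c (Z i w)] i)]%SET| = K.
  rewrite /K /M /Mset size_filter -sum1_count -[X in iota 0 X]subn0.
  rewrite -/(index_iota 0 n) big_mkord sum1dep_card; apply: eq_card => i.
  by rewrite !inE ffunE /signal; case: ifP.
rewrite KE (_ : \sum_(i < n) _ = \sum_(i <- M) hfun (pval (fun i => Z i) i w)).
  by split => /andP.
rewrite /M /Mset big_filter -[X in iota 0 X]subn0 -/(index_iota 0 n) big_mkord.
rewrite [RHS]big_mkcond/=; apply: eq_bigr => i _.
by rewrite ffunE /signal /pval hfun_Phi; case: ifP.
Qed.

(** Rejection at time [n] as a finite disjoint union of cylinders, hence measurable with probability
    a finite sum of products. *)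
Let reject_at n : set T :=
  \bigcup_(f in [set` [seq f <- enum {ffun 'I_n -> option bool} |
     signs_reject alpha f]]) @cyl n f.

Lemma reject_eventE :
  reject_event (fun i => Z i) c alpha = \bigcup_n reject_at n.
Proof.
apply/seteqP; split => w.
  case=> n /signs_rejectE rej; exists n => //.
  exists [ffun i : 'I_n => signal c (Z i w)]; last by move=> i; rewrite ffunE.
  by rewrite /= mem_filter rej mem_enum.
case=> n _ [f /=]; rewrite mem_filter => /andP[rej _] wf; exists n.
apply/signs_rejectE; rewrite (_ : [ffun _ => _] = f)//.
by apply/ffunP => i; rewrite ffunE wf.
Qed.

Lemma measurable_reject_at n : measurable (reject_at n).
Proof.
by apply: fin_bigcup_measurable => // f _; exact: measurable_cyl.
Qed.

Lemma prob_reject_ge n (q : 'I_n -> option bool -> R) :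
  mutually_independent P (fun i => Z i) ->
  (forall (i : 'I_n) o, P (Z i @^-1` (signal c @^-1` [set o])) = (q i o)%:E) ->
  ((\sum_(f : {ffun 'I_n -> option bool} | signs_reject alpha f)
     \prod_i q i (f i))%:E <= P (reject_event (fun i => Z i) c alpha))%E.
Proof.
move=> indep qE; apply: (@le_trans _ _ (P (reject_at n))).
  rewrite measure_fin_bigcup//; last 2 first.
  - by move=> f g _ _ [w [wf wg]]; apply/ffunP => i; rewrite -wf -wg.
  - by move=> f _; exact: measurable_cyl.
  rewrite -fsbig_seq; last by rewrite filter_uniq ?enum_uniq.
  rewrite big_filter big_enum_cond/=.
  rewrite -sumEFin le_eqVlt; apply/orP; left; apply/eqP.
  by apply: eq_bigr => f _; rewrite (prob_cyl _ indep qE).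
rewrite reject_eventE; apply: le_measure; rewrite ?inE.
- exact: measurable_reject_at.
- by apply: bigcup_measurable => k _; exact: measurable_reject_at.
- exact: bigcup_sup.
Qed.

End cylinders.

Theorem theorem9 (R : realType) (d : measure_display) (T : measurableType d)
  (P : probability T R) (Z : nat -> {RV P >-> R})
  (mu : R) (r : nat -> bool) (alpha beta c : R) :
  0 < mu ->
  mutually_independent P (fun i => Z i) ->
  (forall i (A : set R), measurable A ->
     P (Z i @^-1` A) = normal_prob (mu * (r i)%:R) 1 A) ->
  0 < alpha < 1 -> 0 < beta < 1 ->
  (exists k : nat, (1 <= k)%N /\
     (2 * Sfun mu c - 1) *
       (N1 r k - Ck k (beta / 3) * Num.sqrt (N1 r k) / (2 * Pincl mu c))
     >= (Ck k alpha + Ck k (beta / 3)) / Num.sqrt (Pincl mu c) *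
        Num.sqrt (N1 r k + (Dfun mu c)^-1 * N0 r k
                  + Ck k (beta / 3) * Num.sqrt (k%:R) / (2 * Pincl mu c))) ->
  ((1 - beta)%:E <= P (reject_event (fun i => Z i) c alpha))%E.
Proof.
move=> mu0 indep distr alpha01 beta01 [k [k0 cond]].
have p0_01 : 0 <= Pincl 0 c <= 1 by rewrite ltW ?Pincl_gt0//= Pincl_le1.
have := finite_power k0 (Pincl_gt0 mu c) (Pincl_le1 mu c) p0_01
  (Sfun_ge_half c (ltW mu0)) beta01 cond.
rewrite -lee_fin => /le_trans; apply.
apply: (@prob_reject_ge _ _ _ _ _ c alpha k (fun i o => sign_weight
  (if r i then Pincl mu c else Pincl 0 c) (if r i then Sfun mu c else 1 / 2) o)
  indep) => i o.
rewrite distr; last exact: measurable_signal.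
(* A null has mean [mu * 0 = 0], and by symmetry its sign parameter is 1/2. *)
rewrite normal_prob_signal; case: (r i); first by rewrite mulr1.
by rewrite mulr0 Sfun0.
Qed.
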